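(* For every positive integer $M$ there exists a constant $\kappa_M>0$, depending only on $M$, such that for every integer $m\geq M$ and every continuous $m$-homogeneous polynomial $P:c_0\to\mathbb{C}$, with monomial coefficients $c_\alpha(P)$, $$\left(\sum_{\alpha\in\Lambda_M}|c_\alpha(P)|^{\frac{2m}{m+1}}\right)^{\frac{m+1}{2m}}\leq \kappa_M\,\|P\|,$$ where $\Lambda_M$ is the set of all multi-indices $\alpha$ with $|\alpha|=m$ having at most $M$ non-zero entries.
   Context: Here $c_0$ is the complex Banach space of complex sequences converging to $0$, with the supremum norm, and $B_{c_0}$ is its unit ball. A multi-index is a sequence $\alpha=(\alpha_j)_{j=1}^\infty$ of non-negative integers; $|\alpha|=\sum_j\alpha_j$ and $\mathbf{x}^\alpha=\prod_j x_j^{\alpha_j}$. A continuous $m$-homogeneous polynomial $P:c_0\to\mathbb{C}$ is written $P(x)=\sum_{|\alpha|=m}c_\alpha(P)\mathbf{x}^\alpha$; the coefficients $c_\alpha(P)\in\mathbb{C}$ are determined by this expansion on finitely supported sequences $x$. Its norm is $\|P\|=\sup_{x\in B_{c_0}}|P(x)|$. For positive integers $M\leq m$, $\Lambda_M=\{\alpha:\ |\alpha|=m,\ \operatorname{card}\{j:\alpha_j\neq 0\}\leq M\}$ (this set depends on $m$ as well as on $M$). *)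

(* Defs.v *)
From HB Require Import structures.
From mathcomp Require Import all_boot all_order all_algebra.
From mathcomp Require Import all_classical all_reals all_analysis.
From mathcomp Require Import finmap complex.

Set Implicit Arguments.
Unset Strict Implicit.
Unset Printing Implicit Defensive.

Import Order.TTheory GRing.Theory Num.Theory.
Import numFieldNormedType.Exports.
Import ComplexField.Normc.

Local Open Scope classical_set_scope.
Local Open Scope ring_scope.

(* The topology on R[i] is only inferred through the regular algebra [R[i]^o]. *)
Notation CC R := (R[i]^o)%type (only parsing).

Section c0_space.
Context (R : realType).

Definition vanishing : pred (nat -> CC R) :=
  fun x => `[< x @ \oo --> (0 : CC R) >].

Lemma vanishing_submod : submod_closed vanishing.
Proof.
split.
  by apply/asboolP; exact: cvg_cst.
move=> a x y /asboolP hx /asboolP hy; apply/asboolP.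
rewrite -[0 : CC R](addr0 (0 : CC R)) -{1}(scaler0 (CC R) a).
by apply: cvgD hy; exact: cvgZr.
Qed.

HB.instance Definition _ :=
  GRing.isSubmodClosed.Build _ _ vanishing vanishing_submod.

Record c0 := C0 { c0_val :> nat -> CC R; _ : c0_val \in vanishing }.

HB.instance Definition _ := [isSub for c0_val].
HB.instance Definition _ := [Choice of c0 by <:].
HB.instance Definition _ := [SubChoice_isSubLmodule of c0 by <:].

Definition c0_norm (x : c0) : R := sup (range (fun n => normc (x n))).

Lemma normcE (z : R[i]) : `|z| = (normc z)%:C%C.
Proof. by case: z. Qed.

Lemma normc_ge0 (z : R[i]) : 0 <= normc z.
Proof. by case: z => a b; exact: sqrtr_ge0. Qed.

Lemma c0_bounded (x : c0) : has_sup (range (fun n => normc (x n))).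
Proof.
split; first by exists (normc (x 0%N)), 0%N.
have /asboolP /cvgrPdist_lt /(_ 1 ltr01) [N _ xN] := valP x.
exists (1 + \sum_(i < N) normc (x i)) => _ [n _ <-].
have S0 (P : pred 'I_N) : 0 <= \sum_(i < N | P i) normc (x i).
  by apply: sumr_ge0 => i _; exact: normc_ge0.
case: (leqP N n) => [Nn|nN].
  have := xN n Nn.
  rewrite sub0r normrN normcE -[1]/(1%:C%C) ltcR => /ltW x1.
  by rewrite -[leLHS]addr0 lerD.
by rewrite (bigD1 (Ordinal nN)) //= addrCA lerDl addr_ge0.
Qed.

Lemma c0_norm_ub (x : c0) n : normc (x n) <= c0_norm x.
Proof. by apply: sup_upper_bound; [exact: c0_bounded | exists n]. Qed.

Lemma c0_norm_le (x : c0) (b : R) : (forall n, normc (x n) <= b) -> c0_norm x <= b.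
Proof.
move=> xb; apply: ge_sup; first by exists (normc (x 0%N)), 0%N.
by move=> _ [n _ <-].
Qed.

Lemma c0_normD (x y : c0) :
  (c0_norm (x + y))%:C%C <= (c0_norm x)%:C%C + (c0_norm y)%:C%C :> R[i].
Proof.
rewrite -rmorphD lecR; apply: c0_norm_le => n.
by apply: (le_trans (le_normcD _ _)); rewrite lerD ?c0_norm_ub.
Qed.

Lemma c0_normZ (a : R[i]) (x : c0) :
  (c0_norm (a *: x))%:C%C = `|a| * (c0_norm x)%:C%C.
Proof.
have le (b : R[i]) (y : c0) : c0_norm (b *: y) <= normc b * c0_norm y.
  apply: c0_norm_le => n.
  by rewrite [normc _]normcM ler_wpM2l ?normc_ge0 ?c0_norm_ub.
rewrite normcE -rmorphM; congr (_%:C)%C; apply/le_anti; rewrite le /=.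
have [->|a0] := eqVneq a 0.
  rewrite normc0 mul0r; apply: le_trans (c0_norm_ub _ 0%N); exact: normc_ge0.
have := le a^-1 (a *: x); rewrite scalerK //.
have na0 : 0 < normc a.
  by rewrite lt_neqAle normc_ge0 andbT eq_sym; apply: contra a0 => /eqP /eq0_normc ->.
by rewrite normcV -ler_pdivrMl ?invr_gt0 // invrK.
Qed.

Lemma c0_norm0_eq0 (x : c0) : (c0_norm x)%:C%C = 0 :> R[i] -> x = 0.
Proof.
case=> x0; apply: val_inj; apply/funext => n /=.
apply: eq0_normc; apply/le_anti; rewrite normc_ge0 andbT -x0; exact: c0_norm_ub.
Qed.

HB.instance Definition _ :=
  Lmodule_isNormed.Build R[i] c0 c0_normD c0_normZ c0_norm0_eq0.

Lemma c0_normE (x : c0) : `|x| = (sup (range (fun n => normc (x n))))%:C%C.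
Proof. by []. Qed.

Definition multilinear (m : nat) (A : ('I_m -> c0) -> CC R) :=
  forall (v : 'I_m -> c0) (i : 'I_m),
    linear (fun z : c0 => A (fun j => if j == i then z else v j)).

Definition homogeneous_polynomial (m : nat) (P : c0 -> CC R) :=
  exists2 A : ('I_m -> c0) -> CC R,
    multilinear A & forall x, P x = A (fun=> x).

Definition poly_norm (P : c0 -> CC R) : \bar R :=
  ereal_sup [set (normc (P x))%:E | x in [set x : c0 | `|x| <= 1]].

End c0_space.

Definition multiindex := {fsfun nat -> nat with 0%N}.

Definition mdeg (a : multiindex) : nat := (\sum_(j <- finsupp a) a j)%N.

Definition Lambda (m M : nat) : set multiindex :=
  [set a | mdeg a = m /\ (#|` finsupp a| <= M)%N].

Section coefficients.
Context (R : realType).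

Definition monomial (a : multiindex) (x : nat -> CC R) : CC R :=
  \prod_(j <- finsupp a) x j ^+ a j.

(* For finitely supported [x] only finitely many terms of this sum are nonzero,
   so the finitely supported sum [\sum_(_ \in _)] is the intended one. *)
Definition monomial_coefficients (m : nat) (P : c0 R -> CC R)
    (c : multiindex -> CC R) :=
  forall x : c0 R, finite_set [set j | x j != 0] ->
    P x = \sum_(a \in [set a | mdeg a = m]) c a * monomial a x.
End coefficients.

(* Main.v *)
(* For a monomial [x_{j_1}^{a_1} ... x_{j_k}^{a_k}] fix the exponents [a] and a
   grouping of the variables into [k] classes such that [x_{j_i}] lies in the
   [i]-th class.  Averaging over roots of unity and substituting [y = x^{a_i}]
   in the [i]-th class turns the corresponding part of the polynomial into a
   [k]-linear form [b] of norm at most [1], so that Khintchine's inequality gives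
   [\sum_u A_i(u) <= 2^k] where [A_i(u)^2 = \sum_(j | j_i = u) |b_j|^2].
   The product of the [k] terms [|b_j|^2 / A_i(j_i)], of [m - k] copies of
   [|b_j|^2] and of [\prod_i A_i(j_i)] is [|b_j|^(2m)], so the weighted AM-GM
   inequality bounds [|b_j|^(2m/(m+1))] by their mean.  There are at most
   [(m+1)^k] exponent patterns; since the squares of all the coefficients sum to
   at most [1], a large weight on the [m - k] copies absorbs this polynomial
   growth and leaves a constant depending only on [k].  Averaging over the
   groupings costs a factor [k^k]. *)
Require Import Defs.
From mathcomp Require Import all_boot all_order all_algebra.
From mathcomp Require Import all_classical all_reals all_analysis.
From mathcomp Require Import finmap complex.
From mathcomp Require Import cyclic separable cyclotomic ring.
Set Implicit Arguments.
Unset Strict Implicit.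
Unset Printing Implicit Defensive.
Import Order.TTheory GRing.Theory Num.Theory.
Import numFieldNormedType.Exports.
Import ComplexField.Normc.
Local Open Scope classical_set_scope.
Local Open Scope ring_scope.

(** * Sampling at roots of unity *)

(** In characteristic zero [X^n - 1] is separable, so it has [n] distinct roots; a group of [n] such
    roots contains a primitive one. *)
Lemma prim_root_exists (C : numClosedFieldType) n :
  (n > 0)%N -> exists z : C, n.-primitive_root z.
Proof.
pose p : {poly C} := 'X^n - 1; have [r Dp] := closed_field_poly_normal p.
move=> n_gt0; rewrite (monicP _) ?monicXnsubC // scale1r in Dp.
have rn1: all n.-unity_root r by apply/allP=> z; rewrite -root_prod_XsubC -Dp.
have sz_r: (n < (size r).+1)%N.
  by rewrite -(size_prod_XsubC r id) -Dp size_XnsubC.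
have [|z] := hasP (has_prim_root n_gt0 rn1 _ sz_r); last by exists z.
by rewrite -separable_prod_XsubC -Dp separable_Xn_sub_1 // pnatr_eq0 -lt0n.
Qed.

Lemma sum_unity_root (F : fieldType) n (z : F) :
  z ^+ n = 1 -> \sum_(s < n) z ^+ s = (n * (z == 1))%:R.
Proof.
have [->|z1] := eqVneq z 1 => zn.
  by rewrite muln1 (eq_bigr (fun=> 1)) ?sumr_const ?card_ord // => s _; rewrite expr1n.
rewrite muln0; apply/eqP; have := subrX1 z n; rewrite zn subrr => /esym/eqP.
by rewrite mulf_eq0 subr_eq0 (negPf z1).
Qed.

(** Orthogonality of characters: the sum factors over [V] into geometric sums, each equal to [n] or
    [0]. *)
Lemma sum_torus (F : fieldType) (V : finType) n (u : V -> F) :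
  (forall v, u v ^+ n = 1) ->
  \sum_(t : {ffun V -> 'I_n}) \prod_v u v ^+ t v =
    (n ^ #|V| * [forall v, u v == 1])%:R.
Proof.
move=> un; rewrite -(bigA_distr_bigA (fun v (s : 'I_n) => u v ^+ s)) /=.
rewrite (eq_bigr (fun v => (n * (u v == 1))%:R)) => [|v _]; last exact: sum_unity_root.
rewrite -natr_prod big_split /= prod_nat_const; congr (_ * _)%:R.
have [/forallP u1|] := boolP [forall v, u v == 1].
  by rewrite big1 // => v _; rewrite u1.
by rewrite negb_forall => /existsP[v /negPf uv]; rewrite (bigD1 v) //= uv.
Qed.

Lemma norm_prim_root (C : numClosedFieldType) n (w : C) :
  n.-primitive_root w -> `|w| = 1.
Proof.
move=> pw; apply/eqP; rewrite -(pexpr_eq1 (prim_order_gt0 pw)) //.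
by rewrite -normrX (prim_expr_order pw) normr1.
Qed.

(** Distinct indices may share an exponent vector, so their cross terms survive. This generality
    serves the fourth moment, where the indices are pairs and different pairs can have the same
    total exponent. *)
Lemma parseval (C : numClosedFieldType) (V A : finType) n (w : C)
    (e : A -> V -> nat) (c : A -> C) :
  n.-primitive_root w -> (forall a v, (e a v < n)%N) ->
  \sum_(t : {ffun V -> 'I_n}) `|\sum_a c a * \prod_v (w ^+ t v) ^+ e a v| ^+ 2 =
  (n ^ #|V|)%:R *
    \sum_a \sum_b (c a * (c b)^*) * [forall v, e a v == e b v]%:R.
Proof.
move=> pw en.
have nw : w * w^* = 1 by rewrite -normCK (norm_prim_root pw) expr1n.
rewrite (eq_bigr (fun t : {ffun V -> 'I_n} => \sum_a \sum_b (c a * (c b)^*) *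
    \prod_v (w ^+ e a v * w^* ^+ e b v) ^+ t v)) => [|t _]; last first.
  rewrite normCK rmorph_sum big_distrlr; apply: eq_bigr => a _; apply: eq_bigr => b _.
  rewrite /= rmorphM mulrACA rmorph_prod -big_split /=; congr (_ * _).
  apply: eq_bigr => v _; rewrite !rmorphXn /= exprMn -!exprM.
  by rewrite ![(t v * _)%N]mulnC.
rewrite exchange_big /= mulr_sumr; apply: eq_bigr => a _.
rewrite exchange_big /= mulr_sumr; apply: eq_bigr => b _.
rewrite -mulr_sumr sum_torus => [|v]; last first.
  rewrite exprMn -!exprM ![(_ * n)%N]mulnC !exprM (prim_expr_order pw) -rmorphXn.
  by rewrite /= (prim_expr_order pw) rmorph1 !expr1n mulr1.
rewrite natrM mulrCA; congr (_ * (_ * _%:R)).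
congr nat_of_bool; apply: eq_forallb => v.
have -> : (e a v == e b v) = (w ^+ e a v == w ^+ e b v).
  by rewrite (eq_prim_root_expr pw) !modn_small.
have wb : w ^+ e b v * w^* ^+ e b v = 1 by rewrite -exprMn nw expr1n.
rewrite -[in LHS]wb (inj_eq (mulIf _)) //.
by apply/eqP => w0; move/eqP: wb; rewrite w0 mulr0 eq_sym oner_eq0.
Qed.

Lemma parseval_inj (C : numClosedFieldType) (V A : finType) n (w : C)
    (e : A -> V -> nat) (c : A -> C) :
  n.-primitive_root w -> (forall a v, (e a v < n)%N) ->
  (forall a b, e a =1 e b -> a = b) ->
  \sum_(t : {ffun V -> 'I_n}) `|\sum_a c a * \prod_v (w ^+ t v) ^+ e a v| ^+ 2 =
  (n ^ #|V|)%:R * \sum_a `|c a| ^+ 2.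
Proof.
move=> pw en ie; rewrite (parseval _ pw) //; congr (_ * _); apply: eq_bigr => a _.
rewrite (bigD1 a) //= big1 => [|b ba].
  by rewrite addr0 normCK; case: forallP => [_|[]//]; rewrite mulr1.
case: forallP => [eab|_]; last by rewrite mulr0.
by rewrite (ie b a) ?eqxx // in ba => v; rewrite (eqP (eab v)).
Qed.

(* Hölder's inequality between the first, second and fourth moments, in the
   form [3 B^2 x^2 <= 2 B^3 x + x^4], turns the fourth moment bound into a lower
   bound of the first moment. *)
Lemma khintchine (C : numClosedFieldType) (V A : finType) (w : C) (K : nat)
    (e : A -> V -> nat) (c : A -> C) :
  3.-primitive_root w -> (forall a v, (e a v <= 1)%N) ->
  (forall a b, e a =1 e b -> a = b) ->
  (forall p : A * A, #|[pred q : A * A |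
     [forall v, e p.1 v + e p.2 v == e q.1 v + e q.2 v]%N]| <= K)%N ->
  (3 ^ #|V|)%:R * sqrtC (\sum_a `|c a| ^+ 2) <=
    K%:R * \sum_(t : {ffun V -> 'I_3}) `|\sum_a c a * \prod_v (w ^+ t v) ^+ e a v|.
Proof.
move=> pw e1 ie eK.
set f := fun t : {ffun V -> 'I_3} => \sum_a c a * \prod_v (w ^+ t v) ^+ e a v.
set T : C := _%:R; set s := \sum_a _.
change (T * sqrtC s <= K%:R * \sum_t `|f t|).
have s0 : 0 <= s by apply: sumr_ge0 => a _; rewrite exprn_ge0.
have S2 : \sum_t `|f t| ^+ 2 = T * s.
  by apply: (parseval_inj c pw) => // a v; apply: leq_ltn_trans (e1 a v) _.
(* The square of [f t] has exponents at most [2], still below the order [3] of [w], so Parseval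
   applies to it as well. *)
have S4 : \sum_t `|f t| ^+ 4 <= T * (K%:R * s ^+ 2).
  pose e2 (p : A * A) v := (e p.1 v + e p.2 v)%N.
  pose c2 (p : A * A) := c p.1 * c p.2.
  have -> : \sum_t `|f t| ^+ 4 = \sum_(t : {ffun V -> 'I_3})
      `|\sum_p c2 p * \prod_v (w ^+ t v) ^+ e2 p v| ^+ 2.
    apply: eq_bigr => t _; rewrite (exprM _ 2 2) -normrX [f t ^+ 2]expr2 {1 2}/f /=.
    rewrite big_distrlr pair_big /=; congr (`|_| ^+ 2); apply: eq_bigr => p _.
    by rewrite mulrACA -big_split /=; congr (_ * _); apply: eq_bigr => v _; rewrite exprD.
  rewrite (parseval c2 pw) => [|p v]; last by rewrite ltnS (leq_add (e1 _ _) (e1 _ _)).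
  apply: ler_wpM2l; first exact: ler0n.
  pose E (p q : A * A) : C := [forall v, e2 p v == e2 q v]%:R.
  have E0 p q : 0 <= E p q by exact: ler0n.
  have EC p q : E p q = E q p.
    by rewrite /E; congr (nat_of_bool _)%:R; apply: eq_forallb => v; rewrite eq_sym.
  have s2 : \sum_p `|c2 p| ^+ 2 = s ^+ 2.
    rewrite expr2 big_distrlr pair_big /=; apply: eq_bigr => p _.
    by rewrite normrM exprMn.
  (* Each cross term is split by [2 x y <= x^2 + y^2]. By symmetry of [E] the two halves agree, and
     each row of [E] has at most [K] ones. *)
  apply: (@le_trans _ _ (\sum_p \sum_q (`|c2 p| ^+ 2 * E p q / 2 + `|c2 q| ^+ 2 * E q p / 2))).
    have rhs0 p q : 0 <= `|c2 p| ^+ 2 * E p q / 2 + `|c2 q| ^+ 2 * E q p / 2.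
      by rewrite addr_ge0 ?divr_ge0 ?mulr_ge0 ?exprn_ge0.
    apply: le_trans (_ : `|\sum_p \sum_q (c2 p * (c2 q)^*) * E p q| <= _).
      (* The double sum is nonnegative, since by Parseval its multiple by [T] is a sum of
         squares. *)
      apply: real_ler_norm; apply: ger0_real.
      rewrite -(pmulr_rge0 _ (_ : 0 < T)); last by rewrite ltr0n expn_gt0.
      rewrite -(parseval c2 pw) => [|p v]; last by rewrite ltnS (leq_add (e1 _ _) (e1 _ _)).
      by apply: sumr_ge0 => t _; rewrite exprn_ge0.
    apply: le_trans (ler_norm_sum _ _ _) _; apply: ler_sum => p _.
    apply: le_trans (ler_norm_sum _ _ _) _; apply: ler_sum => q _.
    rewrite (EC q p) -mulrDl normrM [ `|c2 p * _|]normrM norm_conjC (ger0_norm (E0 _ _)) -mulrDl [leRHS]mulrAC.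
    apply: ler_wpM2r => //; rewrite ler_pdivlMr ?ltr0n // -subr_ge0.
    have -> : `|c2 p| ^+ 2 + `|c2 q| ^+ 2 - `|c2 p| * `|c2 q| * 2 = (`|c2 p| - `|c2 q|) ^+ 2.
      by ring.
    by rewrite real_exprn_even_ge0 // rpredB ?normr_real.
  have half : \sum_p \sum_q (`|c2 p| ^+ 2 * E p q / 2) <= K%:R * s ^+ 2 / 2.
    rewrite -s2 mulr_sumr mulr_suml; apply: ler_sum => p _.
    rewrite -mulr_suml ler_wpM2r ?invr_ge0 // -mulr_sumr mulrC ler_wpM2r ?exprn_ge0 //.
    rewrite -natr_sum ler_nat.
    apply: leq_trans (eK p); rewrite -sum1_card [leqRHS]big_mkcond /=.
    by apply: leq_sum => q _; rewrite inE; case: [forall v, _].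
  rewrite (eq_bigr (fun p => \sum_q (`|c2 p| ^+ 2 * E p q / 2) +
     \sum_q (`|c2 q| ^+ 2 * E q p / 2))) => [|p _]; last by rewrite big_split.
  rewrite big_split /= [X in _ + X]exchange_big /=.
  rewrite (le_trans (lerD half half)) // -mulrDr.
  by rewrite -[X in X + X]mul1r -splitr mulr1.
have T0 : 0 <= T by exact: ler0n.
have [->|sN0] := eqVneq s 0.
  by rewrite sqrtC0 mulr0 mulr_ge0 // sumr_ge0.
have [A0 _|a0] := pickP (xpredT : pred A); last first.
  by case/eqP: sN0; rewrite /s big1 // => a; have := a0 a.
have K1 : (1 <= K)%N.
  by apply: leq_trans (eK (A0, A0)); apply/card_gt0P; exists (A0, A0); rewrite inE; apply/forallP.
set r := sqrtC s; have rs : r ^+ 2 = s by rewrite sqrtCK.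
have r_gt0 : 0 < r by rewrite sqrtC_gt0 lt_def sN0.
have r0 := ltW r_gt0.
set B := K%:R * r; have B0 : 0 <= B by rewrite mulr_ge0.
have Sx : \sum_t (3 * B ^+ 2 * `|f t| ^+ 2) <=
    \sum_t (2 * B ^+ 3 * `|f t| + `|f t| ^+ 4).
  apply: ler_sum => t _; rewrite -subr_ge0; set x := `|f t|.
  have -> : 2 * B ^+ 3 * x + x ^+ 4 - 3 * B ^+ 2 * x ^+ 2 =
     x * (x - B) ^+ 2 * (x + 2 * B) by ring.
  have xB : 0 <= (x - B) ^+ 2.
    by rewrite real_exprn_even_ge0 // rpredB ?ger0_real ?normr_ge0.
  by apply: mulr_ge0; [apply: mulr_ge0 => //; exact: normr_ge0 | rewrite addr_ge0 ?mulr_ge0 ?normr_ge0].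
rewrite big_split /= -!mulr_sumr S2 in Sx.
have {Sx} Sx := le_trans Sx (lerD (lexx _) S4).
(* Since [K <= K^2], the fourth moment uses up at most one third of the left side of [Sx]; the rest
   is left for the first moment. *)
have KK : T * (K%:R * s ^+ 2) <= B ^+ 2 * (T * s).
  have -> : B ^+ 2 * (T * s) = T * (K%:R * K%:R * s ^+ 2) by rewrite /B -rs; ring.
  rewrite ler_wpM2l // ler_wpM2r ?exprn_ge0 // ler_peMl //; last by rewrite ler1n.
have {Sx} := le_trans Sx (lerD (lexx _) KK).
have -> : 3 * B ^+ 2 * (T * s) = 2 * B ^+ 2 * (T * s) + B ^+ 2 * (T * s) by ring.
rewrite lerD2r.
have -> : 2 * B ^+ 2 * (T * s) = 2 * B ^+ 2 * r * (T * r) by rewrite -rs; ring.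
have -> S : 2 * B ^+ 3 * S = 2 * B ^+ 2 * r * (K%:R * S) by rewrite /B; ring.
rewrite ler_pM2l // !mulr_gt0 ?exprn_gt0 ?ltr0n // mulr_gt0 ?ltr0n //.
Qed.

(** * Multilinear forms *)

(** The hypothesis says that the multisets of [a, b] and of [c, d] coincide. It is used to count
    collisions in the fourth moment of a multilinear form. *)
Lemma unordered_pairP (T : eqType) (a b c d : T) :
  (forall v, (a == v) + (b == v) = (c == v) + (d == v) :> nat)%N ->
  if c == a then c = a /\ d = b else c = b /\ d = a.
Proof.
move=> h; have [ca|ca] := eqVneq c a.
  split=> //; have := h b; rewrite ca eqxx => /addnI.
  by case: eqVneq.
have /esym := h c; rewrite eqxx [a == c]eq_sym (negPf ca) add0n.
have [->|] := eqVneq b c => // _; split=> //.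
by have := h a; rewrite eqxx (negPf ca) add0n; case: (eqVneq d a).
Qed.

Lemma phase (C : numClosedFieldType) (z : C) :
  {u | `|u| = 1 /\ z * u = `|z|}.
Proof.
have [->|z0] := eqVneq z 0; first by exists 1; rewrite normr1 mul0r normr0.
exists (`|z| / z); rewrite mulrCA divff // mulr1; split=> //.
by rewrite normrM normfV normr_id divff // normr_eq0.
Qed.

Section mixed_norm.
Variables (C : numClosedFieldType) (V : finType) (k : nat).
Implicit Types (b : {ffun 'I_k -> V} -> C).

Lemma prod_tensor (j : {ffun 'I_k -> V}) (z : 'I_k * V -> C) :
  \prod_p z p ^+ (j p.1 == p.2) = \prod_i z (i, j i).
Proof.
rewrite (eq_bigr (fun p => z (p.1, p.2) ^+ (j p.1 == p.2))) => [|[] //].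
rewrite -(pair_bigA _ (fun i v => z (i, v) ^+ (j i == v))) /=.
apply: eq_bigr => i _; rewrite (bigD1 (j i)) //= eqxx big1 ?mulr1 // => v vj.
by rewrite eq_sym (negPf vj).
Qed.

Lemma khintchine_tensor b (w : C) : 3.-primitive_root w ->
  (3 ^ #|{: 'I_k * V}|)%:R * sqrtC (\sum_j `|b j| ^+ 2) <=
    (2 ^ k)%:R * \sum_(t : {ffun 'I_k * V -> 'I_3})
      `|\sum_j b j * \prod_i w ^+ t (i, j i)|.
Proof.
move=> pw.
have := @khintchine C ('I_k * V)%type {ffun 'I_k -> V} w (2 ^ k)
  (fun j p => (j p.1 == p.2) : nat) b pw.
set F := (X in _ -> _ -> _ -> _ <= _ * X) => H.
have -> : \sum_(t : {ffun 'I_k * V -> 'I_3}) `|\sum_j b j * \prod_i w ^+ t (i, j i)| = F.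
  by apply: eq_bigr => t _; congr `|_|; apply: eq_bigr => j _; rewrite prod_tensor.
apply: H => [j p|j l jl|p]; first by case: eqP.
  apply/ffunP => i; have /= := jl (i, j i); rewrite eqxx.
  by case: eqVneq.
(* In each coordinate, [q] either keeps the entries of [p] or swaps them. [ph q] records which, and
   so determines [q]: this is the source of [2 ^ k]. *)
pose ph (q : {ffun 'I_k -> V} * {ffun 'I_k -> V}) := [ffun i => q.1 i == p.1 i].
have E q : q \in [pred q : {ffun 'I_k -> V} * {ffun 'I_k -> V} |
     [forall v, (p.1 v.1 == v.2) + (p.2 v.1 == v.2) ==
                (q.1 v.1 == v.2) + (q.2 v.1 == v.2)]%N] ->
    forall i, if ph q i then q.1 i = p.1 i /\ q.2 i = p.2 i
              else q.1 i = p.2 i /\ q.2 i = p.1 i.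
  rewrite inE => /forallP h i; rewrite ffunE; apply: unordered_pairP => v.
  exact/eqP/(h (i, v)).
rewrite -(@card_in_image _ _ ph) => [|q r /E hq /E hr qr].
  by apply: leq_trans (max_card _) _; rewrite card_ffun card_bool card_ord.
case: q r qr hq hr => q1 q2 [r1 r2] qr hq hr.
by congr (_, _); apply/ffunP => i; have := hq i; have := hr i; rewrite qr;
  case: ifP => _ /= [e1 e2] [e3 e4]; rewrite ?(e1, e2, e3, e4).
Qed.

(** Khintchine bounds each slice [j i = u] by an average over cube roots of unity. For a fixed
    sample, phases placed in slot [i] align the slices, so the sum of their moduli is a single value
    of the form. *)
Lemma mixed_norm b i :
  (forall y : 'I_k -> V -> C, (forall l v, `|y l v| = 1) ->
     `|\sum_j b j * \prod_l y l (j l)| <= 1) ->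
  \sum_u sqrtC (\sum_(j : {ffun 'I_k -> V} | j i == u) `|b j| ^+ 2) <= (2 ^ k)%:R.
Proof.
move=> b1; have [w pw] := prim_root_exists C (isT : (0 < 3)%N).
pose T : C := (3 ^ #|{: 'I_k * V}|)%:R.
have T0 : 0 < T by rewrite ltr0n expn_gt0.
rewrite -(ler_pM2l T0) mulr_sumr.
pose bu u j := b j * (j i == u)%:R.
pose f u (t : {ffun 'I_k * V -> 'I_3}) := \sum_j bu u j * \prod_l w ^+ t (l, j l).
apply: (@le_trans _ _ (\sum_u (2 ^ k)%:R * \sum_t `|f u t|)).
  apply: ler_sum => u _; have := @khintchine_tensor (bu u) w pw.
  rewrite [in X in X -> _](_ : \sum_j `|bu u j| ^+ 2 = \sum_(j : {ffun 'I_k -> V} | j i == u) `|b j| ^+ 2) //.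
  rewrite [RHS]big_mkcond; apply: eq_bigr => j _; rewrite /bu.
  by case: eqP; rewrite ?mulr1 // mulr0 normr0 expr0n.
rewrite -mulr_sumr [leRHS]mulrC ler_wpM2l ?ler0n // exchange_big /=.
have -> : T = \sum_(t : {ffun 'I_k * V -> 'I_3}) 1.
  by rewrite sumr_const card_ffun card_ord.
apply: ler_sum => t _.
pose y l v := w ^+ t (l, v) * (if l == i then sval (phase (f v t)) else 1).
have y1 l v : `|y l v| = 1.
  rewrite normrM normrX (norm_prim_root pw) expr1n mul1r.
  by case: eqP; rewrite ?normr1 //; case: (svalP (phase (f v t))).
apply: le_trans (b1 y y1).
have -> : \sum_j b j * \prod_l y l (j l) = \sum_u `|f u t|.
  rewrite (partition_big (fun j : {ffun 'I_k -> V} => j i) xpredT) //=.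
  apply: eq_bigr => u _; case: (svalP (phase (f u t))) => _ <-.
  rewrite /f mulr_suml big_mkcond /=; apply: eq_bigr => j _; rewrite /bu.
  case: eqP => [ju|]; last by rewrite mulr0 !mul0r.
  rewrite mulr1 -mulrA /y big_split /=; congr (_ * (_ * _)).
  by rewrite -big_mkcond big_pred1_eq ju.
by rewrite real_ler_norm // ger0_real ?sumr_ge0.
Qed.

End mixed_norm.

(** * Multilinear forms extracted from a polynomial *)

Section extraction.
Variables (C : numClosedFieldType) (V : finType) (m : nat).
Local Notation exponent := {ffun V -> 'I_m.+1}.
Implicit Types (c : exponent -> C) (al : exponent).

Definition torus_bounded c := forall x : V -> C, (forall v, `|x v| = 1) ->
  `|\sum_al c al * \prod_v x v ^+ al v| <= 1.

(** An average of rotated copies of the polynomial, with weights of modulus at most [1], stays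
    bounded by [1]; [hQ] says that this average keeps exactly the monomials in [Q]. *)
Lemma torus_bounded_project (G : finType) (r : G -> V -> C) (h : G -> C)
    (Q : pred exponent) c :
  (0 < #|G|)%N -> (forall s v, `|r s v| = 1) -> (forall s, `|h s| <= 1) ->
  (forall al, \sum_s h s * \prod_v r s v ^+ al v = (#|G| * Q al)%:R) ->
  torus_bounded c -> torus_bounded (fun al => c al * (Q al)%:R).
Proof.
move=> G0 r1 h1 hQ cb x x1.
have G0' : 0 < #|G|%:R :> C by rewrite ltr0n.
rewrite -(ler_pM2l G0') mulr1 -[X in X * _]normr_nat -normrM mulr_sumr.
have -> : \sum_al #|G|%:R * (c al * (Q al)%:R * \prod_v x v ^+ al v) =
    \sum_s h s * \sum_al c al * \prod_v (x v * r s v) ^+ al v.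
  under [RHS]eq_bigr => s _ do rewrite mulr_sumr.
  rewrite exchange_big /=; apply: eq_bigr => al _.
  transitivity (c al * \prod_v x v ^+ al v * (#|G| * Q al)%:R); first by rewrite natrM; ring.
  rewrite -hQ mulr_sumr; apply: eq_bigr => s _.
  under [in RHS]eq_bigr => v _ do rewrite exprMn.
  by rewrite big_split /=; ring.
apply: le_trans (ler_norm_sum _ _ _) _.
rewrite -sum1_card natr_sum; apply: ler_sum => s _; rewrite normrM.
by rewrite mulr_ile1 // cb // => v; rewrite normrM x1 r1 mulr1.
Qed.

Variables (k : nat) (g : V -> 'I_k).

(** All variables of class [i] are rotated by a common root of unity, and the average is taken
    against the character of degree [a i]. *)
Lemma torus_bounded_degree c (a : 'I_k -> nat) : (forall i, (a i <= m)%N) ->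
  torus_bounded c ->
  torus_bounded (fun al => c al *
    [forall i, \sum_(v | g v == i) al v == a i]%N%:R).
Proof.
(* [n] exceeds every class degree and every [a i], so equality modulo [n] is equality. *)
move=> am; set n := (\sum_(v : V) m + m).+1.
have [z pz] := prim_root_exists C (isT : (0 < n)%N).
have z1 := norm_prim_root pz; have z0 : z != 0 by rewrite -normr_eq0 z1 oner_neq0.
apply: (@torus_bounded_project {ffun 'I_k -> 'I_n} (fun s v => z ^+ s (g v))
  (fun s => \prod_i (z ^- a i) ^+ s i)).
- by rewrite card_ffun card_ord expn_gt0.
- by move=> s v; rewrite normrX z1 expr1n.
- move=> s; rewrite normr_prod big1 // => i _.
  by rewrite normrX normfV normrX z1 !(expr1n, invr1).
move=> al; set e := fun i => (\sum_(v | g v == i) al v)%N.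
have en i : (e i < n)%N.
  rewrite ltnS (leq_trans _ (leq_addr _ _)) // /e big_mkcond leq_sum // => v _.
  by case: ifP => // _; rewrite -ltnS.
transitivity (\sum_(s : {ffun 'I_k -> 'I_n}) \prod_i (z ^- a i * z ^+ e i) ^+ s i).
  apply: eq_bigr => s _; under [RHS]eq_bigr => i _ do rewrite exprMn.
  rewrite big_split /=; congr (_ * _); rewrite (partition_big g xpredT) //=.
  apply: eq_bigr => i _; rewrite -exprM mulnC exprM /e -prodrXr.
  by apply: eq_bigr => v /eqP ->; rewrite -!exprM mulnC.
rewrite sum_torus => [|i].
  rewrite card_ffun !card_ord; congr (_ * nat_of_bool _)%:R.
  apply: eq_forallb => i; rewrite -[(_ == a i)%N]/(e i == a i).
  rewrite mulrC -subr_eq0 -(inj_eq (mulIf (expf_neq0 (a i) z0))) mul0r mulrBl mul1r.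
  rewrite divfK ?expf_neq0 // subr_eq0 (eq_prim_root_expr pz) !modn_small //.
  by rewrite ltnS (leq_trans (am i)) // leq_addl.
rewrite exprMn -exprVn -!exprM ![(_ * n)%N]mulnC !exprM exprVn.
by rewrite (prim_expr_order pz) invr1 !expr1n mulr1.
Qed.

(** Each variable is rotated independently by the [d v]-th roots of unity, all of them powers of one
    primitive root of order [D]. *)
Lemma torus_bounded_dvdn c (d : V -> nat) : (forall v, 0 < d v)%N ->
  torus_bounded c ->
  torus_bounded (fun al => c al * [forall v, d v %| al v]%N%:R).
Proof.
move=> d0; set D := (\prod_v d v)%N.
have D0 : (0 < D)%N by rewrite prodn_gt0.
have dD v : (d v %| D)%N by rewrite /D (bigD1 v) //= dvdn_mulr.
have [z pz] := prim_root_exists C D0.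
apply: (@torus_bounded_project {ffun V -> 'I_D} (fun t v => (z ^+ (D %/ d v)) ^+ t v)
  (fun=> 1)).
- by rewrite card_ffun card_ord expn_gt0 D0.
- by move=> t v; rewrite !normrX (norm_prim_root pz) !expr1n.
- by move=> t; rewrite normr1.
move=> al.
transitivity (\sum_(t : {ffun V -> 'I_D}) \prod_v (z ^+ (D %/ d v * al v)) ^+ t v).
  apply: eq_bigr => t _; rewrite mul1r; apply: eq_bigr => v _.
  by rewrite -!exprM -!mulnA [(al v * _)%N]mulnC.
rewrite sum_torus => [|v]; last by rewrite -exprM mulnC exprM (prim_expr_order pz) expr1n.
rewrite card_ffun card_ord; congr (_ * nat_of_bool _)%:R; apply: eq_forallb => v.
rewrite -(prim_order_dvd pz) -[X in (X %| _)%N](divnK (dD v)) dvdn_pmul2l //.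
by rewrite divn_gt0 // dvdn_leq.
Qed.

Definition is_section (j : {ffun 'I_k -> V}) := [forall i, g (j i) == i].

(* The exponent of [\prod_i x_(j i) ^+ a i], provided that [j] is a section. *)
Definition spread (a : {ffun 'I_k -> 'I_m.+1}) (j : {ffun 'I_k -> V}) : exponent :=
  [ffun v => if j (g v) == v then a (g v) else ord0].

Lemma spread_inj (a a' : {ffun 'I_k -> 'I_m.+1}) j j' :
  (forall i, 0 < a i)%N -> is_section j -> is_section j' ->
  spread a j = spread a' j' -> a = a' /\ j = j'.
Proof.
move=> a0 /forallP sj /forallP sj' E.
have H i : j i = j' i /\ a i = a' i.
  have := congr1 (fun al : exponent => al (j i)) E.
  rewrite !ffunE (eqP (sj i)) eqxx; case: eqP => [-> //|_ ai].
  by have := a0 i; rewrite ai.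
by split; apply/ffunP => i; case: (H i).
Qed.

(** If every exponent in class [i] is a multiple of [a i] and they add up to [a i > 0], then one
    variable carries all of [a i] and the others have exponent [0]. *)
Lemma spreadP (a : {ffun 'I_k -> 'I_m.+1}) (al : exponent) :
  (forall i, 0 < a i)%N ->
  reflect (exists2 j, is_section j & al = spread a j)
    ([forall v, a (g v) %| al v] && [forall i, \sum_(v | g v == i) al v == a i])%N.
Proof.
move=> a0; apply: (iffP andP) => [[/forallP dv /forallP sm]|[j /forallP sj ->]].
  have ex i : exists v, [&& g v == i, al v == a i &
      [forall v', (g v' == i) ==> (v != v') ==> (al v' == ord0)]].
    have [v /andP[gv av]] : exists v, (g v == i) && (al v != ord0).
      apply/existsP; apply: contraT; rewrite negb_exists => /forallP al0.
      have := sm i; rewrite big1 => [/eqP ai|v gv]; first by have := a0 i; rewrite -ai.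
      by have := al0 v; rewrite gv negbK => /eqP ->.
    exists v; rewrite gv /=; have := sm i; rewrite (bigD1 v) //= => /eqP si.
    have ai : (a i <= al v)%N by rewrite -(eqP gv) dvdn_leq // lt0n.
    have ri : (\sum_(w | (g w == i) && (w != v)) al w = 0)%N.
      by apply/eqP; rewrite -leqn0 -(leq_add2l (al v)) si addn0.
    rewrite -val_eqE /= -si ri addn0 eqxx /=.
    apply/forallP => w; apply/implyP => gw; apply/implyP => wv; apply/eqP/val_inj => /=.
    by apply/eqP; rewrite -leqn0 -ri (bigD1 w) /= ?gw 1?eq_sym ?wv // leq_addr.
  have [j jP] := fin_all_exists ex.
  have gj i : g (j i) = i by case/and3P: (jP i) => /eqP.
  exists [ffun i => j i]; first by apply/forallP => i; rewrite ffunE gj.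
  apply/ffunP => v; rewrite !ffunE.
  have /and3P[_ /eqP ej /forallP/(_ v)] := jP (g v); rewrite eqxx /= => /implyP nj.
  have [jv|/nj/eqP //] := eqVneq (j (g v)) v; first by rewrite -ej jv.
split; apply/forallP.
  by move=> v; rewrite ffunE; case: ifP => // _; rewrite dvdn0.
move=> i; rewrite (bigD1 (j i)) //= ffunE (eqP (sj i)) eqxx big1 ?addn0 // => v.
by case/andP=> /eqP gv vj; rewrite ffunE gv eq_sym (negPf vj).
Qed.

(** The degree and divisibility projections leave only the monomials [spread a j], in which
    variables of class [i] enter through their [a i]-th powers. Taking [a i]-th roots of [y] turns
    the polynomial into the multilinear form. *)
Lemma torus_bounded_sections c (a : {ffun 'I_k -> 'I_m.+1}) (y : 'I_k -> V -> C) :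
  (forall i, 0 < a i)%N -> torus_bounded c -> (forall i v, `|y i v| = 1) ->
  `|\sum_j (c (spread a j) * (is_section j)%:R) * \prod_i y i (j i)| <= 1.
Proof.
move=> a0 cb y1.
have {}cb := torus_bounded_dvdn (fun v => a0 (g v))
  (torus_bounded_degree (fun i => ltn_ord (a i) : a i <= m)%N cb).
pose x v := (a (g v)).-root (y (g v) v).
have x1 v : `|x v| = 1 by rewrite norm_rootC y1 rootC1.
have := cb x x1; congr (`|_| <= 1); rewrite [RHS](eq_bigr (fun j =>
    if is_section j then c (spread a j) * \prod_i y i (j i) else 0)) => [|j _]; last first.
  by case: ifP => _; rewrite ?mulr1 // mulr0 mul0r.
rewrite -big_mkcond /=; pose D := [pred j | is_section j].
rewrite (eq_bigr (fun al : exponent => if al \in imset (spread a) (mem D)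
    then c al * \prod_v x v ^+ al v else 0)) => [|al _]; last first.
  have -> : (al \in imset (spread a) (mem D)) =
      ([forall v, a (g v) %| al v] && [forall i, \sum_(v | g v == i) al v == a i])%N.
    by apply/imsetP/(spreadP al a0) => -[j]; exists j.
  by rewrite -mulrA mulrC; case: ifP => [/andP[-> ->]|];
    [rewrite !mul1r mulr1 // mulrC | case: [forall v, _] => /= [->|_]; rewrite ?mulr0 ?mul0r ?mulr0].
rewrite -big_mkcond big_imset /= => [|j j' sj sj' /(spread_inj a0 sj sj')[]//].
apply: eq_bigr => j /forallP sj; congr (_ * _).
rewrite (partition_big g xpredT) //=; apply: eq_bigr => i _.
rewrite (bigD1 (j i)) //= ffunE (eqP (sj i)) eqxx big1 => [|v].
  by rewrite mulr1 /x (eqP (sj i)) rootCK.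
by case/andP=> /eqP gv vj; rewrite ffunE gv eq_sym (negPf vj).
Qed.

End extraction.

(** * Arithmetic-geometric means for a fixed exponent pattern *)

(** The [k + r + 1] numbers averaged are the [k] quotients, [r] copies of [mu * x ^+ 2] and the last
    term, whose coefficient cancels all weights in the product. *)
Lemma root_AGM (C : numClosedFieldType) k r (x lam mu : C) (A : 'I_k -> C) :
  0 <= x -> 0 < lam -> 0 < mu -> (forall i, 0 <= A i) ->
  (x != 0 -> forall i, A i != 0) ->
  (k + r).+1%:R * (k + r).+1.-root (x ^+ (2 * (k + r))) <=
    \sum_i lam * (x ^+ 2 / A i) + r%:R * (mu * x ^+ 2) +
    lam ^- k * mu ^- r * \prod_i A i.
Proof.
move=> x0 lam0 mu0 A0 An.
have [->|xn] := eqVneq x 0; last first.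
  pose E (s : 'I_k + ('I_r + 'I_1)) := match s with
    | inl i => lam * (x ^+ 2 / A i)
    | inr (inl _) => mu * x ^+ 2
    | inr (inr _) => lam ^- k * mu ^- r * \prod_i A i
    end.
  have cE : #|{: 'I_k + ('I_r + 'I_1)}| = (k + r).+1.
    by rewrite !card_sum !card_ord addnA addn1.
  have E0 s : 0 <= E s.
    case: s => [i|[_|_]] /=; rewrite ?mulr_ge0 ?invr_ge0 ?exprn_ge0 ?(ltW lam0) ?(ltW mu0) //.
    by apply: prodr_ge0.
  have /= := @leif_rootC_AGM C _ predT E (fun s _ => E0 s).
  rewrite cE => -[+ _]; rewrite ler_pdivlMr ?ltr0n // mulrC.
  rewrite !big_sumType /= !big_ord1 sumr_const card_ord -[_ *+ r]mulr_natl addrA.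
  congr (_ * _.-root _ <= _).
  rewrite !big_split /= !prodr_const !card_ord prodfV.
  rewrite (eq_bigl xpredT) // !mul2n -!addnn !exprD.
  have lk : lam ^+ k != 0 by rewrite expf_neq0 // gt_eqF.
  have mr : mu ^+ r != 0 by rewrite expf_neq0 // gt_eqF.
  have pA : \prod_i A i != 0 by apply/prodf_neq0 => i _; exact: An.
  by field; rewrite lk mr.
rewrite expr0n muln_eq0 /=.
have rhs : 0 <= lam ^- k * mu ^- r * \prod_i A i.
  by rewrite ?mulr_ge0 ?invr_ge0 ?exprn_ge0 ?(ltW lam0) ?(ltW mu0) ?prodr_ge0.
(* For [k + r = 0] the left side is [0 ^+ 0 = 1], matched by the empty product; otherwise it
   vanishes. *)
case E: (k + r)%N => [|n] /=.
  move/eqP: E; rewrite addn_eq0 => /andP[/eqP k0 /eqP r0]; subst k r.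
  by rewrite !big_ord0 !expr0 !invr1 !mulr1 !mul1r mul0r !add0r root1C.
by rewrite rootC0 mulr0 !addr_ge0 // ?expr0n ?mulr0 // sumr_ge0 // => i _; rewrite mul0r mulr0.
Qed.

Section pattern.
Variables (C : numClosedFieldType) (V : finType) (k r : nat).
Local Notation m := (k + r)%N.
Local Notation exponent := {ffun V -> 'I_m.+1}.
Variables (g : V -> 'I_k) (c : exponent -> C).
Hypothesis cb : torus_bounded c.

Local Notation F al := (m.+1.-root (`|c al| ^+ (2 * m))).

(* The weights [B i u] make both [\sum_j |b j|^2 / B i (j i) = \sum_u B i u] and
   [\sum_j \prod_i B i (j i) = \prod_i \sum_u B i u] bounded. *)
Lemma pattern_bound (a : {ffun 'I_k -> 'I_m.+1}) (lam mu : C) :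
  (forall i, 0 < a i)%N -> 0 < lam -> 0 < mu ->
  m.+1%:R * \sum_(j | is_section g j) F (spread g a j) <=
    lam * (k * 2 ^ k)%:R +
    r%:R * mu * \sum_(j | is_section g j) `|c (spread g a j)| ^+ 2 +
    lam ^- k * mu ^- r * ((2 ^ k) ^ k)%:R.
Proof.
move=> a0 lam0 mu0.
pose b (j : {ffun 'I_k -> V}) := c (spread g a j) * (is_section g j)%:R.
pose B i u := sqrtC (\sum_(j : {ffun 'I_k -> V} | j i == u) `|b j| ^+ 2).
have b1 (y : 'I_k -> V -> C) : (forall l v, `|y l v| = 1) ->
    `|\sum_j b j * \prod_l y l (j l)| <= 1.
  exact: torus_bounded_sections.
have B0 i u : 0 <= B i u.
  by rewrite sqrtC_ge0 sumr_ge0 // => j _; rewrite exprn_ge0.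
have SB i : \sum_u B i u <= (2 ^ k)%:R := mixed_norm i b1.
have Bb j : b j != 0 -> forall i, B i (j i) != 0.
  move=> bj i; rewrite sqrtC_eq0 (bigD1 j) //= gt_eqF // ltr_wpDr //.
    by apply: sumr_ge0 => l _; rewrite exprn_ge0.
  by rewrite exprn_gt0 // normr_gt0.
have bE j : is_section g j -> b j = c (spread g a j) by rewrite /b => ->; rewrite mulr1.
apply: (@le_trans _ _ (\sum_j (\sum_i lam * (`|b j| ^+ 2 / B i (j i)) +
   r%:R * (mu * `|b j| ^+ 2) + lam ^- k * mu ^- r * \prod_i B i (j i)))).
  rewrite mulr_sumr big_mkcond /=; apply: ler_sum => j _.
  have := @root_AGM C k r `|b j| lam mu (fun i => B i (j i)) (normr_ge0 _) lam0 mu0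
    (fun i => B0 i (j i)).
  rewrite normr_eq0 => /(_ (@Bb j)).
  case: ifP => [/bE -> //|_]; apply: le_trans.
  by rewrite mulr_ge0 ?ler0n // rootC_ge0 // exprn_ge0.
rewrite !big_split /=; apply: lerD; first apply: lerD.
- have -> : lam * (k * 2 ^ k)%:R = \sum_(i < k) lam * (2 ^ k)%:R.
    by rewrite sumr_const card_ord -[RHS]mulr_natl natrM mulrCA.
  rewrite exchange_big /=; apply: ler_sum => i _.
  rewrite -mulr_sumr ler_wpM2l ?(ltW lam0) //; apply: le_trans (SB i).
  rewrite (partition_big (fun j : {ffun 'I_k -> V} => j i) xpredT) //= ler_sum // => u _.
  rewrite (eq_bigr (fun j => `|b j| ^+ 2 / B i u)) => [|j /eqP -> //].
  (* The inner sum is [B i u ^+ 2 / B i u], which is [B i u] even at zero, where the quotient is [0]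
     by convention. *)
  rewrite -mulr_suml -[X in X / _]sqrtCK -/(B i u).
  by have [->|Bn] := eqVneq (B i u) 0; rewrite ?mul0r ?expr0n ?mul0r // expr2 mulfK.
- rewrite -mulr_sumr -mulr_sumr mulrA ler_wpM2l ?mulr_ge0 ?ler0n ?(ltW mu0) //.
  rewrite [leRHS]big_mkcond /=; apply: ler_sum => j _; case: ifP => [/bE -> //|sj].
  by rewrite /b sj mulr0 normr0 expr0n.
rewrite -mulr_sumr ler_wpM2l ?mulr_ge0 ?invr_ge0 ?exprn_ge0 ?(ltW lam0) ?(ltW mu0) //.
rewrite -(bigA_distr_bigA (fun i u => B i u)) natrX /=.
rewrite -[X in _ <= _ ^+ X]card_ord -prodr_const.
by apply: ler_prod => i _; rewrite SB sumr_ge0.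
Qed.
End pattern.

(** Exponents up to [m] stay distinct modulo [m + 1], so Parseval at roots of unity of that order
    sees every coefficient separately. *)
Lemma torus_bounded_l2 (C : numClosedFieldType) (V : finType) m
    (c : {ffun V -> 'I_m.+1} -> C) :
  torus_bounded c -> \sum_al `|c al| ^+ 2 <= 1.
Proof.
move=> cb; have [w pw] := prim_root_exists C (isT : (0 < m.+1)%N).
have T0 : 0 < (m.+1 ^ #|V|)%:R :> C by rewrite ltr0n expn_gt0.
rewrite -(ler_pM2l T0) -(parseval_inj c pw (fun (al : {ffun V -> 'I_m.+1}) v => ltn_ord (al v))).
  apply: (@le_trans _ _ (\sum_(t : {ffun V -> 'I_m.+1}) 1)).
    apply: ler_sum => t _; rewrite exprn_ile1 // cb // => v.
    by rewrite normrX (norm_prim_root pw) expr1n.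
  by rewrite sumr_const card_ffun card_ord mulr1.
by move=> al be ab; apply/ffunP => v; apply/val_inj/ab.
Qed.

Lemma leq_succ_add_mul_exp k r : ((k + r).+1 <= k.+1 * 2 ^ r)%N.
Proof.
elim: r => [|r IH]; first by rewrite addn0 muln1.
rewrite addnS expnS mulnCA mul2n -addnn.
by apply: leq_trans (leq_add IH IH); rewrite -addn1 leq_add.
Qed.

(** * Averaging over groupings of the variables *)

Section good_grouping.
Variables (R : numDomainType) (V : finType) (m k : nat).
Local Notation exponent := {ffun V -> 'I_m.+1}.

(* Averaging over all groupings [g : V -> 'I_k]: the fraction of the groupings
   that separate the [k] variables of a given monomial is at least [k ^- k]. *)
Lemma grouping_average (F : exponent -> R) (K : R) : (0 < k)%N ->
  (forall al, 0 <= F al) ->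
  (forall g : V -> 'I_k, \sum_(a : {ffun 'I_k -> 'I_m.+1} | [forall i, a i != ord0])
      \sum_(j | is_section g j) F (spread g a j) <= K) ->
  \sum_(al : exponent | #|[pred v | al v != ord0]| == k) F al <= (k ^ k)%:R * K.
Proof.
move=> k0 F0 FK.
pose good (g : {ffun V -> 'I_k}) (al : exponent) :=
  [exists p : {ffun 'I_k -> 'I_m.+1} * {ffun 'I_k -> V},
     [&& [forall i, p.1 i != ord0], is_section g p.2 & spread g p.1 p.2 == al]].
have goodK g : \sum_(al | good g al) F al <= K.
  apply: le_trans (FK g); rewrite pair_big_dep /=.
  rewrite (partition_big (fun p => spread g p.1 p.2) xpredT) //= big_mkcond /=.
  apply: ler_sum => al _; case: ifP => [/existsP[p /and3P[p1 p2 /eqP pal]]|_].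
    rewrite (bigD1 p) /= ?p1 ?p2 ?pal ?eqxx // lerDl.
    by apply: sumr_ge0 => q _; exact: F0.
  by apply: sumr_ge0 => q _; exact: F0.
have count (al : exponent) : #|[pred v | al v != ord0]| == k ->
    (k ^ #|V| <= k ^ k * #|[pred g : {ffun V -> 'I_k} | good g al]|)%N.
  move=> /eqP sk.
  have [s [s_inj s_supp]] : exists s : 'I_k -> V, injective s /\
      forall v, (al v != ord0) = (v \in codom s).
    exists (fun i => enum_val (cast_ord (esym sk) i)); split.
      by move=> i i' /enum_val_inj/cast_ord_inj.
    move=> v; apply/idP/codomP => [av|[i ->]].
      have av' : v \in [pred v | al v != ord0] by [].
      exists (cast_ord sk (enum_rank_in av' v)).
      by rewrite cast_ordK enum_rankK_in.
    by have := enum_valP (cast_ord (esym sk) i).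
  (* [fix_on h] moves [s i] to class [i], hence is good. Together with the [k] overwritten values it
     determines [h], so each good grouping comes from at most [k ^ k] maps [h]. *)
  pose fix_on (h : {ffun V -> 'I_k}) : {ffun V -> 'I_k} :=
    [ffun v => if [pick i | s i == v] is Some i then i else h v].
  have fixE h i : fix_on h (s i) = i.
    by rewrite ffunE; case: pickP => [i' /eqP/s_inj //|/(_ i)]; rewrite eqxx.
  have fix_good h : good (fix_on h) al.
    apply/existsP; exists ([ffun i => al (s i)], [ffun i => s i]) => /=.
    apply/and3P; split.
    - by apply/forallP => i; rewrite ffunE s_supp codom_f.
    - by apply/forallP => i; rewrite [X in fix_on h X]ffunE fixE.
    apply/eqP/ffunP => v; rewrite ffunE.
    have : forall i, s i = v -> fix_on h v = i by move=> i <-; exact: fixE.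
    move: (fix_on h v) => i0 i0P; rewrite !ffunE.
    case: eqP => [-> //|nv]; apply/esym/eqP/negPn; rewrite s_supp.
    by apply/negP => /codomP[i vi]; case: nv; rewrite (i0P i).
  pose Phi h := (fix_on h, [ffun i => h (s i)]).
  have Phi_inj : injective Phi.
    move=> h h' [hh /ffunP ss]; apply/ffunP => v.
    have [/codomP[i ->]|vs] := boolP (v \in codom s).
      by have := ss i; rewrite !ffunE.
    have := congr1 (fun f : {ffun V -> 'I_k} => f v) hh; rewrite !ffunE.
    by case: pickP => [i /eqP vi|//]; rewrite -vi codom_f in vs.
  rewrite -[X in (_ ^ #|_| <= X ^ _ * _)%N]card_ord -[X in (_ <= _ ^ X * _)%N]card_ord.
  rewrite -[X in (X ^ #|_| <= _)%N]card_ord -!card_ffun mulnC -cardX.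
  rewrite -(fintype.card_image Phi_inj); apply/fintype.subset_leq_card/fintype.subsetP => _ /codomP[h ->].
  by rewrite !inE fix_good.
rewrite -(ler_pM2l (_ : 0 < (k ^ #|V|)%:R)) ?ltr0n ?expn_gt0 ?k0 // mulr_sumr.
apply: (@le_trans _ _ (\sum_(al : exponent) (k ^ k)%:R * \sum_(g : {ffun V -> 'I_k} | good g al) F al)).
  rewrite big_mkcond; apply: ler_sum => al _; case: ifP => [/count cal|_]; last first.
    by rewrite mulr_ge0 ?ler0n // sumr_ge0.
  rewrite sumr_const -[X in _ <= _ * X]mulr_natl mulrA -natrM ler_wpM2r // ler_nat.
  by apply: leq_trans cal _.
rewrite -mulr_sumr mulrCA ler_wpM2l ?ler0n //.
rewrite (exchange_big_dep xpredT) //=.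
apply: (@le_trans _ _ (\sum_(g : {ffun V -> 'I_k}) K)).
  by apply: ler_sum => g _; exact: goodK.
by rewrite sumr_const card_ffun card_ord mulr_natl.
Qed.
End good_grouping.

(** * Summation over exponent patterns *)

(** [spread] is injective on these pairs, so the left side is a partial sum of the right one. *)
Lemma sum_spread_le (R : numDomainType) (V : finType) m k (g : V -> 'I_k)
    (f : {ffun V -> 'I_m.+1} -> R) :
  (forall al, 0 <= f al) ->
  \sum_(a : {ffun 'I_k -> 'I_m.+1} | [forall i, a i != ord0])
    \sum_(j | is_section g j) f (spread g a j) <= \sum_al f al.
Proof.
move=> f0; rewrite pair_big_dep /=.
pose D := [pred p : {ffun 'I_k -> 'I_m.+1} * {ffun 'I_k -> V} |
  [forall i, p.1 i != ord0] && is_section g p.2].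
rewrite -(big_imset (h := fun p => spread g p.1 p.2) (A := D) f) /=.
  by rewrite big_mkcond ler_sum // => al _; case: ifP.
move=> [a j] [a' j'] /andP[/forallP a0 sj] /andP[_ sj'] /= E.
have [|-> -> //] := @spread_inj V m k g a a' j j' _ sj sj' E.
by move=> i; rewrite lt0n; exact: a0.
Qed.

(** One summand for each of the three terms of [pattern_bound], summed over all patterns and divided
    by [m + 1]. *)
Definition monomial_type_bound k : nat :=
  (k * 2 ^ k + 2 ^ (k * k.+1) + k.+1 ^ (k * k.+1) * (2 ^ k) ^ k)%N.

Section support_card.
Variables (C : numClosedFieldType) (V : finType).

Lemma grouping_bound k r (c : {ffun V -> 'I_(k + r).+1} -> C) (g : V -> 'I_k) :
  torus_bounded c ->
  \sum_(a : {ffun 'I_k -> 'I_(k + r).+1} | [forall i, a i != ord0])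
    \sum_(j | is_section g j)
      (k + r).+1.-root (`|c (spread g a j)| ^+ (2 * (k + r))) <=
  (monomial_type_bound k)%:R.
Proof.
move=> cb; set m := (k + r)%N.
(* [lam] compensates for the number of patterns, which is at most [W]; [mu ^+ r]
   dominates [W ^ k.+1] up to a constant, by [m.+1 <= k.+1 * 2 ^ r]. *)
pose W := (m.+1 ^ k)%N; pose e := (k * k.+1)%N.
pose lam : C := W%:R^-1; pose mu : C := (2 ^ e)%:R.
have W0 : 0 < W%:R :> C by rewrite ltr0n expn_gt0.
have lam0 : 0 < lam by rewrite invr_gt0.
have mu0 : 0 < mu by rewrite ltr0n expn_gt0.
rewrite -(ler_pM2l (ltr0Sn C m)) mulr_sumr.
pose D := [pred a : {ffun 'I_k -> 'I_m.+1} | [forall i, a i != ord0]].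
have DW : (#|D| <= W)%N.
  by apply: leq_trans (max_card _) _; rewrite card_ffun !card_ord.
set Q := fun a : {ffun 'I_k -> 'I_m.+1} =>
  \sum_(j | is_section g j) `|c (spread g a j)| ^+ 2.
apply: (@le_trans _ _ (\sum_(a | D a) (lam * (k * 2 ^ k)%:R + r%:R * mu * Q a +
    lam ^- k * mu ^- r * ((2 ^ k) ^ k)%:R))).
  apply: ler_sum => a /forallP a0; apply: pattern_bound => // i.
  by rewrite lt0n; exact: a0.
rewrite !big_split /= !sumr_const -mulr_sumr -[in leLHS]mulrnAl.
(* The squares are bounded over all patterns at once, so the term carrying [mu] does not pay for the
   number of patterns. *)
have QE : \sum_(a | D a) Q a <= 1.
  apply: le_trans (torus_bounded_l2 cb).
  by apply: sum_spread_le => al; rewrite exprn_ge0.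
have T1 : lam *+ #|D| * (k * 2 ^ k)%:R <= (k * 2 ^ k)%:R.
  rewrite ler_piMl ?ler0n // -mulr_natl /lam ler_pdivrMr // mul1r ler_nat //.
have T2 : r%:R * mu * \sum_(a | D a) Q a <= r%:R * mu.
  by rewrite ler_piMr // mulr_ge0 ?ler0n // ltW.
have T3 : lam ^- k * mu ^- r * ((2 ^ k) ^ k)%:R *+ #|D| <=
    (k.+1 ^ e * (2 ^ k) ^ k)%:R.
  rewrite -mulr_natl mulrA natrM ler_wpM2r ?ler0n // mulrA.
  rewrite ler_pdivrMr ?exprn_gt0 // /lam exprVn invrK -!natrX -!natrM ler_nat.
  apply: (@leq_trans (W * W ^ k)); first by rewrite leq_mul2r DW orbT.
  rewrite -expnS /W -[leqLHS]expnM -/e.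
  have -> : ((2 ^ e) ^ r = (2 ^ r) ^ e)%N by rewrite -!expnM mulnC.
  rewrite -expnMn; have [e0|e0] := posnP e; first by rewrite e0 !expn0.
  by rewrite leq_exp2r // leq_succ_add_mul_exp.
apply: le_trans (lerD (lerD T1 T2) T3) _.
rewrite /monomial_type_bound -/e /mu -!natrM -!natrD -?natrM ler_nat.
(* The factor [m + 1] on the right absorbs the factor [r] of the middle term. *)
rewrite !mulnDr leq_add ?leq_pmull // leq_add ?leq_pmull //.
by rewrite leq_mul2r leqW ?orbT // leq_addl.
Qed.

Lemma support_card_bound m k (c : {ffun V -> 'I_m.+1} -> C) :
  (0 < k <= m)%N -> torus_bounded c ->
  \sum_(al : {ffun V -> 'I_m.+1} | #|[pred v | al v != ord0]| == k)
     m.+1.-root (`|c al| ^+ (2 * m)) <= (k ^ k * monomial_type_bound k)%:R.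
Proof.
case/andP=> k0 /subnKC; set r := (m - k)%N => mE; case: _ / mE in c * => cb.
rewrite natrM; apply: grouping_average => // [al|g].
  by rewrite rootC_ge0 // exprn_ge0.
exact: grouping_bound.
Qed.
End support_card.

(** * Multi-indices and finitely supported vectors *)

Lemma big_finsupp_ord (R : Type) (idx : R) (op : Monoid.com_law idx) N
    (a : multiindex) (f : nat -> nat -> R) :
  (forall j, j \in finsupp a -> (j < N)%N) -> (forall j, f j 0%N = idx) ->
  \big[op/idx]_(j <- finsupp a) f j (a j) = \big[op/idx]_(v < N) f v (a v).
Proof.
move=> aN f0; rewrite -(big_mkord xpredT (fun j => f j (a j))).
rewrite [RHS](bigID (fun j => j \in finsupp a)) /= [X in op _ X]big1 => [|j ja]; last first.
  by rewrite (fsfun_dflt ja) f0.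
rewrite Monoid.mulm1 -[RHS]big_filter; apply: perm_big; apply: uniq_perm.
- exact: fset_uniq.
- by rewrite filter_uniq // iota_uniq.
move=> j; rewrite mem_filter mem_index_iota /=.
by case: (boolP (j \in finsupp a)) => [/aN ->|].
Qed.

Section multiindex_extension.
Variables (N m : nat).
Local Notation exponent := {ffun 'I_N -> 'I_m.+1}.

Definition mi_extend (al : exponent) : multiindex :=
  [fsfun j in [fset j in iota 0 N]%fset => (if insub j is Some v then al v : nat else 0)%N | 0%N].

(** [inord] sends entries above [m] to [0]; this does not occur in degree [m], where [mi_restrict]
    inverts [mi_extend] on supports below [N]. *)
Definition mi_restrict (a : multiindex) : exponent := [ffun v : 'I_N => inord (a v)].

Lemma mi_extendE al (v : 'I_N) : mi_extend al v = al v.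
Proof. by rewrite fsfunE !inE mem_iota ltn_ord valK. Qed.

Lemma finsupp_mi_extend al j : j \in finsupp (mi_extend al) -> (j < N)%N.
Proof.
rewrite mem_finsupp fsfunE !inE mem_iota /= add0n.
by case: ltnP.
Qed.

Lemma mdeg_mi_extend al : mdeg (mi_extend al) = (\sum_v al v)%N.
Proof.
rewrite /mdeg (@big_finsupp_ord _ _ _ N _ (fun _ n => n) (@finsupp_mi_extend al)) //.
by apply: eq_bigr => v _; rewrite mi_extendE.
Qed.

Lemma card_finsupp_mi_extend al :
  #|` finsupp (mi_extend al)| = #|[pred v | al v != ord0]|.
Proof.
rewrite -sum1_size -sum1_card [RHS]big_mkcond /=.
transitivity (\sum_(j <- finsupp (mi_extend al)) (mi_extend al j != 0))%N.
  by apply: eq_big_seq => j; rewrite mem_finsupp => ->.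
rewrite (@big_finsupp_ord _ _ _ N _ (fun _ n => nat_of_bool (n != 0%N))
  (@finsupp_mi_extend al)) //.
by apply: eq_bigr => v _; rewrite mi_extendE inE -val_eqE; case: eqP.
Qed.

Lemma monomial_mi_extend (R : realType) al (x : nat -> R[i]) :
  monomial (mi_extend al) x = \prod_(v < N) x v ^+ al v.
Proof.
rewrite /monomial (@big_finsupp_ord _ _ _ N _ (fun j n => x j ^+ n)
  (@finsupp_mi_extend al)) //.
by apply: eq_bigr => v _; rewrite mi_extendE.
Qed.

Lemma mi_extend_inj : injective mi_extend.
Proof.
move=> al be ab; apply/ffunP => v; apply/val_inj.
by rewrite /= -!mi_extendE ab.
Qed.

Lemma mi_restrictK (a : multiindex) :
  (forall j, j \in finsupp a -> (j < N)%N) -> mdeg a = m ->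
  mi_extend (mi_restrict a) = a.
Proof.
move=> aN am; apply/fsfunP => j; have [jN|Nj] := ltnP j N.
  rewrite -[j]/(val (Ordinal jN)) mi_extendE ffunE inordK // ltnS -am.
  have [ja|/fsfun_dflt -> //] := boolP (j \in finsupp a).
  by rewrite /mdeg (big_fsetD1 _ ja) /= leq_addr.
rewrite !fsfun_dflt //; first by apply/negP => /aN; rewrite ltnNge Nj.
by apply/negP => /finsupp_mi_extend; rewrite ltnNge Nj.
Qed.

End multiindex_extension.

Section evaluation.
Variable R : realType.

Definition zero_extend N (x : 'I_N -> R[i]) (j : nat) : CC R :=
  if insub j is Some v then x v else 0.

Lemma zero_extendE N (x : 'I_N -> R[i]) (v : 'I_N) : zero_extend x v = x v.
Proof. by rewrite /zero_extend valK. Qed.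

Lemma zero_extend_out N (x : 'I_N -> R[i]) j : (N <= j)%N -> zero_extend x j = 0.
Proof. by move=> Nj; rewrite /zero_extend insubF // ltnNge Nj. Qed.

Lemma zero_extend_vanishing N (x : 'I_N -> R[i]) : zero_extend x \in @vanishing R.
Proof.
apply/asboolP; apply: cvg_near_cst; exists N => // j Nj.
exact: zero_extend_out.
Qed.

Lemma monomial_coefficients_eval N m (P : c0 R -> CC R) (c : multiindex -> CC R)
    (x : 'I_N -> R[i]) :
  monomial_coefficients m P c ->
  P (C0 (zero_extend_vanishing x)) =
    \sum_(al : {ffun 'I_N -> 'I_m.+1} | (\sum_v al v == m)%N)
      c (mi_extend al) * \prod_v x v ^+ al v.
Proof.
move=> hP; rewrite hP; last first.
  apply: (sub_finite_set _ (finite_II N)) => j /= jx.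
  by rewrite ltnNge; apply: contra jx => /(zero_extend_out x) /= ->.
set r := [seq mi_extend al | al <- enum [pred al : {ffun 'I_N -> 'I_m.+1} | (\sum_v al v == m)%N]].
rewrite (@fsbigE _ _ _ _ _ r).
- rewrite big_map big_enum_cond /=.
  apply: eq_big => [al|al _]; last first.
    rewrite monomial_mi_extend; congr (_ * _); apply: eq_bigr => v _ /=.
    by rewrite zero_extendE.
  rewrite inE; case: eqP => //= alm; apply: mem_set => /=.
  by rewrite mdeg_mi_extend.
- by rewrite map_inj_uniq ?enum_uniq //; exact: mi_extend_inj.
- by move=> _ /= /mapP[al + ->]; rewrite mem_enum mdeg_mi_extend => /eqP.
move=> a /= am ar.
(* A multi-index of degree [m] missing from [r] involves a variable beyond the first [N], where the
   point is zero, so its monomial vanishes. *)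
have /existsP[[j ja] /= Nj] : [exists j : finsupp a, (N <= val j)%N].
  apply: contraNT ar; rewrite negb_exists => /forallP aN.
  have aN' j : j \in finsupp a -> (j < N)%N.
    by move=> ja; have := aN [`ja]%fset; rewrite -ltnNge.
  rewrite -(mi_restrictK aN' am); apply: map_f.
  by rewrite mem_enum inE -mdeg_mi_extend mi_restrictK // am.
rewrite /monomial (big_fsetD1 _ ja) /= zero_extend_out // expr0n.
by move: ja; rewrite mem_finsupp => /negPf ->; rewrite mul0r mulr0.
Qed.

Lemma c0_norm_zero_extend N (x : 'I_N -> R[i]) : (forall v, `|x v| = 1) ->
  `|C0 (zero_extend_vanishing x)| <= 1 :> R[i].
Proof.
move=> x1; rewrite c0_normE -[1]/(1%:C%C) lecR; apply: c0_norm_le => j /=.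
have [jN|Nj] := ltnP j N; last by rewrite zero_extend_out // normc0.
rewrite -[j]/(val (Ordinal jN)) zero_extendE.
by rewrite -lecR -Defs.normcE x1.
Qed.

Lemma poly_norm_torus N m (P : c0 R -> CC R) (c : multiindex -> CC R) (L : R)
    (x : 'I_N -> R[i]) :
  monomial_coefficients m P c -> (poly_norm P <= L%:E)%E ->
  (forall v, `|x v| = 1) ->
  `|\sum_(al : {ffun 'I_N -> 'I_m.+1} | (\sum_v al v == m)%N)
      c (mi_extend al) * \prod_v x v ^+ al v| <= L%:C%C :> R[i].
Proof.
move=> hP PL x1; rewrite -(monomial_coefficients_eval _ hP) Defs.normcE lecR -lee_fin.
apply: le_trans PL; apply: ereal_sup_ubound.
by exists (C0 (zero_extend_vanishing x)) => //=; exact: c0_norm_zero_extend.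
Qed.

End evaluation.

(** * Passage to real powers and infinite sums *)

Section conclusion.
Variable R : realType.

Definition BH_exponent m : R := (2 * m)%:R / (m + 1)%:R.

(** Translates the roots in [R[i]] of the finite estimates into the real powers of the final
    inequality. *)
Lemma root_normE m (z : R[i]) :
  m.+1.-root (`|z| ^+ (2 * m)) = (normc z `^ BH_exponent m)%:C%C.
Proof.
have -> : `|z| ^+ (2 * m) = (normc z `^ BH_exponent m)%:C%C ^+ m.+1 :> R[i].
  rewrite Defs.normcE -!rmorphXn /=; congr (_%:C)%C.
  rewrite -[RHS]powR_mulrn ?powR_ge0 // -powRrM /BH_exponent.
  by rewrite addn1 divfK ?pnatr_eq0 // powR_mulrn // normc_ge0.
by rewrite exprCK // -[0]/(0%:C)%C lecR powR_ge0.
Qed.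

Definition BH_constant M : nat := (\sum_(k < M.+1) k ^ k * monomial_type_bound k)%N.

Lemma finite_sum_bound M m (c : multiindex -> CC R) (L : R) (X : set multiindex) :
  (0 < M <= m)%N -> 0 < L ->
  (forall N (x : 'I_N -> R[i]), (forall v, `|x v| = 1) ->
    `|\sum_(al : {ffun 'I_N -> 'I_m.+1} | (\sum_v al v == m)%N)
      c (mi_extend al) * \prod_v x v ^+ al v| <= L%:C%C :> R[i]) ->
  finite_set X -> X `<=` Lambda m M ->
  \sum_(a \in X) normc (c a) `^ BH_exponent m <=
    (BH_constant M)%:R * L `^ BH_exponent m.
Proof.
move=> /andP[M0 Mm] L0 cL finX XL; rewrite fsbig_finite //.
have sX a : a \in fset_set X -> Lambda m M a by rewrite in_fset_set // => /set_mem/XL.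
set s : seq multiindex := fset_set X in sX *.
pose N := (\max_(a <- s) \max_(j <- finsupp a) j).+1.
have aN a j : a \in s -> j \in finsupp a -> (j < N)%N.
  move=> sa ja; rewrite ltnS; apply: leq_trans (leq_bigmax_seq _ sa isT).
  exact: (@leq_bigmax_seq _ _ xpredT id).
have LC0 : 0 < L%:C%C :> R[i] by rewrite -[0]/(0%:C)%C ltcR.
(* Dividing by [L] normalizes the bound on the torus to [1]; exponents of degree other than [m] get
   coefficient [0]. *)
pose c' (al : {ffun 'I_N -> 'I_m.+1}) : R[i] :=
  if (\sum_v al v == m)%N then c (mi_extend al) / L%:C%C else 0.
have cb : torus_bounded c'.
  move=> x x1; rewrite -(ler_pM2l LC0) mulr1 -{1}(gtr0_norm LC0) -normrM.
  apply: le_trans (cL N x x1); rewrite mulr_sumr [in leRHS]big_mkcond /=.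
  rewrite le_eqVlt; apply/orP; left; apply/eqP; congr `|_|; apply: eq_bigr => al _.
  rewrite /c'; case: ifP => _; last by rewrite mul0r mulr0.
  by rewrite mulrCA mulrA -[_ / _ * _]mulrA; field; rewrite gt_eqF.
pose F (al : {ffun 'I_N -> 'I_m.+1}) := m.+1.-root (`|c' al| ^+ (2 * m)).
have F0 al : 0 <= F al by rewrite rootC_ge0 // exprn_ge0.
have FK : \sum_(k < M.+1) \sum_(al : {ffun 'I_N -> 'I_m.+1} |
    #|[pred v | al v != ord0]| == k) F al <= (BH_constant M)%:R.
  rewrite natr_sum; apply: ler_sum => -[k kM] _ /=.
  (* An empty support means degree [0], which differs from [m], so the terms with [k = 0] vanish. *)
  have [k0|k0] := posnP k; last first.
    by apply: support_card_bound cb; rewrite k0 (leq_trans _ Mm).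
  rewrite big1 ?ler0n // k0 => al /eqP/card0_eq al0; rewrite /F /c' ifN.
    by rewrite normr0 expr0n muln_eq0 /= gtn_eqF ?rootC0 // (leq_trans M0).
  rewrite big1 => [|v _]; first by rewrite ltn_eqF // (leq_trans M0).
  by have := al0 v; rewrite inE => /negbFE/eqP ->.
have sE a : a \in s -> (normc (c a) `^ BH_exponent m)%:C%C =
    F (mi_restrict N m a) * (L `^ BH_exponent m)%:C%C.
  move=> sa; have [am _] := sX a sa; rewrite /F root_normE -rmorphM; congr (_%:C)%C.
  have rK := mi_restrictK (fun j => aN a j sa) am.
  rewrite /c' -mdeg_mi_extend rK am eqxx -powRM ?normc_ge0 ?(ltW L0) //.
  congr (_ `^ _); rewrite normcM -fmorphV /=.
  by rewrite expr0n addr0 sqrtr_sqr gtr0_norm ?invr_gt0 // divfK // gt_eqF.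
rewrite -lecR rmorph_sum rmorphM rmorph_nat /= (eq_big_seq _ sE) -mulr_suml.
rewrite ler_wpM2r //; first by rewrite -[0]/(0%:C)%C lecR powR_ge0.
apply: le_trans FK.
rewrite -(big_map (mi_restrict N m) xpredT F) big_uniq /=; last first.
  rewrite map_inj_in_uniq ?fset_uniq // => a b sa sb ab.
  have [am _] := sX a sa; have [bm _] := sX b sb.
  rewrite -(mi_restrictK (fun j => aN a j sa) am) ab.
  by rewrite (mi_restrictK (fun j => aN b j sb) bm).
rewrite (exchange_big_dep xpredT) //= big_mkcond; apply: ler_sum => al _.
case: ifP => [/mapP[a sa ->]|_]; last by rewrite sumr_ge0.
have [am aM] := sX a sa.
rewrite -card_finsupp_mi_extend (mi_restrictK (fun j => aN a j sa) am).
rewrite (bigD1 (Ordinal (aM : (_ < M.+1)%N))) //= lerDl sumr_ge0 //.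
Qed.

End conclusion.

Theorem theorem1p1 (R : realType) (M : nat) (M_gt0 : (0 < M)%N) :
  exists2 kappa : R, 0 < kappa &
    forall (m : nat) (P : c0 R -> R[i]^o) (c : multiindex -> R[i]^o),
      (M <= m)%N ->
      homogeneous_polynomial m P -> continuous P ->
      monomial_coefficients m P c ->
      ((\esum_(a in Lambda m M)
          (normc (c a) `^ ((2 * m)%:R / (m + 1)%:R))%:E)
        `^ ((m + 1)%:R / (2 * m)%:R)
       <= kappa%:E * poly_norm P)%E.
Proof.
pose K : R := (BH_constant M).+1%:R.
have K0 : 0 < K by rewrite ltr0n.
exists K => // m P c Mm _ _ cP.
have m0 : (0 < m)%N by exact: leq_trans Mm.
set p : R := (2 * m)%:R / (m + 1)%:R.
set q : R := (m + 1)%:R / (2 * m)%:R.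
have q0 : 0 <= q by rewrite divr_ge0 ?ler0n.
have q1 : q <= 1.
  by rewrite ler_pdivrMr ?ltr0n ?muln_gt0 // mul1r ler_nat mul2n -addnn leq_add2l.
have pq : p * q = 1.
  by rewrite /p /q mulrA divfK ?divff // pnatr_eq0 -lt0n ?muln_gt0 ?addn1.
have bound (L : R) : 0 < L -> (poly_norm P <= L%:E)%E ->
    ((\esum_(a in Lambda m M) (normc (c a) `^ p)%:E) `^ q <= (K * L)%:E)%E.
  move=> L0 PL.
  have S : (\esum_(a in Lambda m M) (normc (c a) `^ p)%:E <= (K * L `^ p)%:E)%E.
    apply: ub_ereal_sup => _ [X [finX XL] <-]; rewrite fsumEFin // lee_fin.
    apply: le_trans (finite_sum_bound _ L0 _ finX XL) _; rewrite ?M_gt0 //.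
      by move=> N x x1; exact: (poly_norm_torus cP PL x1).
    by rewrite ler_wpM2r ?powR_ge0 // ler_nat.
  apply: le_trans (gt0_ler_poweR q0 _ _ S) _.
  - rewrite in_itv /= leey andbT; apply: esum_ge0 => a _.
    by rewrite lee_fin powR_ge0.
  - by rewrite in_itv /= leey andbT lee_fin mulr_ge0 ?powR_ge0 // ltW.
  rewrite poweR_EFin lee_fin powRM ?powR_ge0 ?(ltW K0) // -powRrM pq powRr1 ?(ltW L0) //.
  rewrite ler_wpM2r ?(ltW L0) // -[leRHS]powRr1 ?(ltW K0) //.
  by apply: ler_powR => //; rewrite /K ler1n.
have P0 : (0 <= poly_norm P)%E.
  apply: le_trans (_ : (normc (P 0))%:E <= _)%E; first by rewrite lee_fin normc_ge0.
  by apply: ereal_sup_ubound; exists 0 => //=; rewrite normr0.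
(* An infinite norm makes the right side infinite. A finite norm [L] may be zero, so [bound] is
   applied to [L + e / K] for every [e > 0]. *)
case: (poly_norm P) P0 bound => [L|_ _|//]; last by rewrite gt0_muley ?leey ?lte_fin.
rewrite lee_fin => L0 bound; apply/lee_addgt0Pr => e e0.
apply: le_trans (bound (L + e / K) _ _) _; first by rewrite ltr_wpDl ?divr_gt0.
  by rewrite lee_fin lerDl ltW // divr_gt0.
by rewrite -EFinM -EFinD lee_fin mulrDr mulrCA divff ?mulr1 // gt_eqF.
Qed.
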